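(* For all positive integers $n$ and $m$, \[ \omega(nm)\geq \min(\omega(n),\omega(m)). \]
   Context: For a positive integer $k$, $\mathbb{Z}_k$ denotes the integers modulo $k$. $G_k$ is the simple graph whose vertices are all functions $f:\mathbb{Z}_k\to\mathbb{Z}_k$, where two distinct vertices $f,g$ form an edge if and only if the pointwise difference $f-g$ (taken modulo $k$) is a bijection $\mathbb{Z}_k\to\mathbb{Z}_k$. $\omega(k)$ denotes the size of the largest clique (complete subgraph) in $G_k$. *)

(* Defs.v *)
From HB Require Import structures.
From mathcomp Require Import all_boot all_order all_algebra.

Set Implicit Arguments.
Unset Strict Implicit.
Unset Printing Implicit Defensive.

Import GRing.Theory.

(* For k > 0, k.-1.+1 = k, and 'I_(k.-1.+1) carries the canonical zmodType of
   the integers modulo k. ['Z_k] is not used because 'Z_1 is Z/2 rather than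
   the trivial group. (The notation is also meaningful for k = 0, where it is
   a junk value.) *)
Notation Zmod k := 'I_(k.-1.+1).

Notation vertex k := {ffun Zmod k -> Zmod k}.

Definition bijectiveb (T U : finType) (h : T -> U) : bool :=
  injectiveb h && [forall y, exists x, h x == y].

Lemma bijectivebP (T U : finType) (h : T -> U) :
  reflect (bijective h) (bijectiveb h).
Proof.
apply: (iffP andP) => [[/injectiveP inj_h /forallP sur_h]|[g hK gK]].
  have sur y : exists x, h x == y by apply/existsP.
  exists (fun y => xchoose (sur y)) => [x|y]; last exact/eqP/(xchooseP (sur y)).
  exact/inj_h/eqP/(xchooseP (sur (h x))).
split; first by apply/injectiveP; apply: can_inj hK.
by apply/forallP=> y; apply/existsP; exists (g y); rewrite gK.
Qed.

(* [f - g] is the pointwise difference in the additive group of functions. *)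
Definition edge (k : nat) : rel (vertex k) :=
  fun f g => (f != g) && bijectiveb (f - g)%R.

Lemma edge_irrefl k : irreflexive (@edge k).
Proof. by move=> f; rewrite /edge eqxx. Qed.

Lemma edge_sym k : symmetric (@edge k).
Proof.
suff imp (f g : vertex k) : edge f g -> edge g f.
  by move=> f g; apply/idP/idP; apply: imp.
case/andP=> neq_fg /bijectivebP[h fgK hK]; rewrite /edge eq_sym neq_fg /=.
have oppE x : (g - f)%R x = (- (f - g)%R x)%R by rewrite !ffunE opprB.
apply/bijectivebP; exists (fun y => h (- y)%R) => [x|y].
  by rewrite oppE opprK fgK.
by rewrite oppE hK opprK.
Qed.

Definition is_clique (T : finType) (e : rel T) (A : {set T}) : bool :=
  [forall f in A, forall g in A, (f != g) ==> e f g].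

Definition omega (k : nat) : nat :=
  \max_(A : {set vertex k} | is_clique (@edge k) A) #|A|.

(* Main.v *)
Require Import Defs.
From mathcomp Require Import all_boot all_order all_algebra.

Set Implicit Arguments.
Unset Strict Implicit.
Unset Printing Implicit Defensive.

(** Write the elements of Z_(nm) as a + n b with 0 <= a < n and 0 <= b < m.
Given cliques (f_i) in G_n and (g_i) in G_m of the same size, put
h_i (a + n b) = f_i a + n (g_i b). The value (h_i - h_j)(a + n b) modulo n is
(f_i - f_j) a, which determines a; once a is known, n (g_i - g_j) b modulo nm
determines b. So the h_i form a clique in G_(nm). *)

(* The right-hand side is the injectivity of [f - g], rearranged so
   that it can be read in nat without subtraction. *)
Lemma inj_subP (k : nat) (f g : vertex k) : 0 < k ->
  injective (f - g)%R <->
  (forall x y, f x + g y = f y + g x %[mod k] -> x = y).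
Proof.
case: k f g => // k f g _; have eqE x y : (f - g)%R x = (f - g)%R y <->
    f x + g y = f y + g x %[mod k.+1].
  rewrite !ffunE; split=> [/eqP|fg].
    by rewrite GRing.subr_eq GRing.addrAC eq_sym GRing.subr_eq
      => /eqP/(congr1 val).
  apply/eqP; rewrite GRing.subr_eq GRing.addrAC eq_sym GRing.subr_eq.
  by apply/eqP/val_inj; rewrite /= -fg.
by split=> inj x y /eqE/inj.
Qed.

Lemma edgeE (k : nat) (f g : vertex k) :
  edge f g <-> f <> g /\ injective (f - g)%R.
Proof.
split=> [/andP[/eqP neq_fg /bijectivebP/bij_inj]|[/eqP neq_fg inj_fg]] //.
by apply/andP; split=> //; apply/bijectivebP/injF_bij.
Qed.

(** Any part of a clique is a clique, so every [r] up to [omega k] is reached. Families indexed by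
    ['I_r] let two cliques be paired by index. Injectivity of [F] is a separate condition because
    for [k = 1] the zero difference is injective too. *)
Lemma leq_omegaP (k r : nat) :
  r <= omega k <->
  exists2 F : 'I_r -> vertex k, injective F &
    forall i j, i != j -> injective (F i - F j)%R.
Proof.
split=> [le_r | [F F_inj F_edge]].
  (* The maximum is attained, since the empty set is a clique. *)
  have [|A cliqueA omegaA] :=
    @eq_bigmax_cond _ (is_clique (@edge k)) (fun A => #|A|).
    apply/card_gt0P; exists set0.
    by apply/forall_inP=> f; rewrite inE.
  rewrite /omega omegaA in le_r.
  have F_inj : injective (fun i : 'I_r => enum_val (widen_ord le_r i)).
    by move=> i j /enum_val_inj/(congr1 val)/= /val_inj.
  exists (fun i => enum_val (widen_ord le_r i)) => // i j neq_ij.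
  have /forall_inP/(_ _ (enum_valP (widen_ord le_r i)))/forall_inP
    /(_ _ (enum_valP (widen_ord le_r j)))/implyP := cliqueA.
  by rewrite (inj_eq F_inj) => /(_ neq_ij)/edgeE[].
have -> : r = #|[set F i | i : 'I_r]| by rewrite card_imset // card_ord.
rewrite /omega; apply: leq_bigmax_cond.
apply/forall_inP=> _ /imsetP[i _ ->]; apply/forall_inP=> _ /imsetP[j _ ->].
apply/implyP=> neq_F; apply/edgeE; split; first exact/eqP.
by apply: F_edge; rewrite -(inj_eq F_inj).
Qed.

Lemma val_inZp (k a : nat) : 0 < k -> (inZp a : Zmod k) = a %% k :> nat.
Proof. by move=> hk; rewrite /= prednK. Qed.

Lemma ltn_Zmod (k : nat) (a : Zmod k) : 0 < k -> a < k.
Proof. by move=> hk; rewrite -[X in _ < X]prednK. Qed.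

(** For positive [n] and [m], the outer [inZp] and the one around [x %/ n] only change the type:
    both arguments are already in range. The inner [inZp x] does reduce, to the digit a. *)
Definition glue (n m : nat) (f : vertex n) (g : vertex m) : vertex (n * m) :=
  [ffun x : Zmod (n * m) => inZp (f (inZp x) + n * g (inZp (x %/ n)))].

Lemma glueE (n m : nat) (f : vertex n) (g : vertex m) x : 0 < n -> 0 < m ->
  glue f g x = f (inZp x) + n * g (inZp (x %/ n)) %[mod n * m].
Proof.
by move=> hn hm; rewrite ffunE val_inZp ?muln_gt0 ?hn // modn_mod.
Qed.

Lemma glue_modn (n m : nat) (f : vertex n) (g : vertex m) x :
  0 < n -> 0 < m -> glue f g x = f (inZp x) %[mod n].
Proof.
move=> hn hm; rewrite -(modn_dvdm _ (dvdn_mulr m (dvdnn n))) glueE //.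
by rewrite modn_dvdm ?dvdn_mulr // addnC mulnC modnMDl.
Qed.

(** At a point [a < n] the glued function has residue [f a] modulo [n], so distinctness in the first
    clique alone keeps the glued vertices distinct. *)
Lemma glue_injl (n m : nat) (f f' : vertex n) (g g' : vertex m) :
  0 < n -> 0 < m -> glue f g = glue f' g' -> f = f'.
Proof.
move=> hn hm eq_glue; apply/ffunP=> a; apply: val_inj.
have lt_a : a < (n * m).-1.+1.
  rewrite (@prednK (n * m)) ?muln_gt0 ?hn //.
  by rewrite (leq_trans (ltn_Zmod a hn)) ?leq_pmulr.
have := glue_modn f g (Ordinal lt_a) hn hm.
by rewrite eq_glue glue_modn //= valZpK !modn_small ?ltn_Zmod.
Qed.

Lemma glue_sub_inj (n m : nat) (f f' : vertex n) (g g' : vertex m) :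
  0 < n -> 0 < m -> injective (f - f')%R -> injective (g - g')%R ->
  injective (glue f g - glue f' g')%R.
Proof.
move=> hn hm /(inj_subP _ _ hn) inj_f /(inj_subP _ _ hm) inj_g.
have hnm : 0 < n * m by rewrite muln_gt0 hn.
apply/(inj_subP _ _ hnm) => x y eq_xy.
have eq_a : inZp x = inZp y :> Zmod n.
  apply: inj_f.
  have := congr1 (modn^~ n) eq_xy.
  rewrite !modn_dvdm ?dvdn_mulr // -modnDm !glue_modn // modnDm.
  by rewrite -[in RHS]modnDm !glue_modn // modnDm.
have eq_b : inZp (x %/ n) = inZp (y %/ n) :> Zmod m.
  apply: inj_g.
  move: eq_xy; rewrite -modnDm !glueE // modnDm -[in RHS]modnDm !glueE // modnDm.
  (* As the low digits agree, both sides contain the same values of [f] and [f']. Cancelling them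
     leaves n u = n v modulo n m, hence u = v modulo m. *)
  rewrite eq_a addnACA [in RHS]addnACA -!mulnDr => /eqP.
  by rewrite eqn_modDl -!muln_modr eqn_pmul2l // => /eqP.
(* The quotients lie below [m], so their congruence modulo [m] is an equality. *)
have lt_nm (z : Zmod (n * m)) : z %/ n < m.
  by rewrite ltn_divLR // [X in _ < X]mulnC ltn_Zmod.
move/(congr1 val): eq_a; move/(congr1 val): eq_b.
rewrite /= (prednK hn) (prednK hm) !(modn_small (lt_nm _)) => eq_b eq_a.
by apply: val_inj; rewrite /= (divn_eq x n) eq_a eq_b -divn_eq.
Qed.

Theorem proposition1 (n m : nat) (hn : 0 < n) (hm : 0 < m) :
  omega (n * m) >= minn (omega n) (omega m).
Proof.
have /leq_omegaP[F F_inj F_sub] := geq_minl (omega n) (omega m).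
have /leq_omegaP[G _ G_sub] := geq_minr (omega n) (omega m).
apply/leq_omegaP; exists (fun i => glue (F i) (G i)) => [i j|i j neq_ij].
  by move/(glue_injl hn hm)/F_inj.
by apply: glue_sub_inj => //; [apply: F_sub | apply: G_sub].
Qed.
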